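(* Let $\hat\beta\subset V$ be a closed $n$-braid which is a knot. Then the canonical loop $rot(\hat\beta)\subset M_n$ is never tangential to $\Sigma^{(1)}_{tan}$; that is, whenever the loop $rot(\hat\beta)$ passes through a point of $\Sigma^{(1)}_{tan}$, it intersects $\Sigma^{(1)}_{tan}$ transversely there.
   Context: Everything is smooth. Use coordinates $(\phi,\rho,z)$ on $\mathbb R^3\setminus(z\text{-axis})$, with $(\phi,\rho)\in S^1\times\mathbb R^+$ polar coordinates of $\{z=0\}$. The solid torus is $V=S^1\times D^2$, embedded as a neighbourhood of the core $\{\rho=1,z=0\}$, where the disc $\{\phi\}\times D^2$ is a round disc in the $(\rho,z)$-half plane centred at $(1,0)$. A closed $n$-braid is an oriented link $\hat\beta\subset V$ on which $\phi$ is non-singular and with $[\hat\beta]=n\in H_1(V)\cong\mathbb Z$. $M_n$ is the (infinite-dimensional) space of all closed $n$-braids which are knots. Diagrams are taken with respect to the projection $pr(\phi,\rho,z)=(\phi,\rho)$. $\Sigma^{(1)}_{tan}\subset M_n$ is the codimension-one stratum of closed braids whose projection under $pr$ has, besides ordinary double points, exactly one ordinary autotangency, i.e. a point where two branches, written as graphs $\rho=\rho_1(\phi)$ and $\rho=\rho_2(\phi)$, satisfy $\rho_1-\rho_2=0$, $(\rho_1-\rho_2)'=0$, $(\rho_1-\rho_2)''\ne0$. A one-parameter family of closed braids with local branches $\rho_i(\phi,t)$ passing at $t=t_0$ through such a point at $\phi=\phi_0$ is transverse to $\Sigma^{(1)}_{tan}$ if $\partial_t(\rho_1-\rho_2)(\phi_0,t_0)\neq0$,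 and tangential to it otherwise. The canonical loop $rot(\hat\beta)$ is the loop $(\hat\beta_t)_{t\in[0,2\pi]}$ in $M_n$ obtained by applying to $\hat\beta$ the rotation by the angle $t$ of all discs $\{\phi\}\times D^2$ simultaneously around their centres. *)

(* Defs.v *)
From Stdlib Require Import Reals.
From Coquelicot Require Import Coquelicot.
Open Scope R_scope.

Definition polar (phi rho : R) : R * R := (rho * cos phi, rho * sin phi).

(* The point of R^3 with cylindrical coordinates (phi, rho, z).  The angle phi
   is a real number, so it represents its class in S^1 = R / 2 pi Z; the
   coordinate system proper requires 0 < rho. *)
Definition cyl (phi rho z : R) : R * R * R := (polar phi rho, z).

Definition pr (p : R * R * R) : R * R := fst p.

(* The solid torus V, with meridian discs of radius r; for r < 1 it does not
   meet the z-axis. *)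
Definition solid_torus (r : R) (p : R * R * R) : Prop :=
  exists phi rho z, 0 < rho /\ (rho - 1) ^ 2 + z ^ 2 <= r ^ 2 /\
    p = cyl phi rho z.

Definition smooth (f : R -> R) : Prop := forall k x, ex_derive_n f k x.

Definition smooth_near (f : R -> R) (x0 : R) : Prop :=
  locally x0 (fun x => forall k, ex_derive_n f k x).

Definition smooth_near_2d (f : R -> R -> R) (x0 y0 : R) : Prop :=
  locally_2d (fun x y => forall k, ex_diff_n f k x y) x0 y0.

(* [closed_braid_knot r n K]: K belongs to M_n.  The knot K is the image of an
   embedding of the circle R / Z, given by a lift (Phi, rho, z) of its
   cylindrical coordinates to R x R^+ x R.  The class of K in H_1(V) = Z is the
   number of turns made by Phi over one period.  For n > 0 the orientation of K
   is the one for which phi increases, so it is determined by the set K; for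
   n = 0 no such K exists. *)
Definition closed_braid_knot (r : R) (n : nat) (K : R * R * R -> Prop) : Prop :=
  exists Phi rho z : R -> R,
    smooth Phi /\ smooth rho /\ smooth z /\
    (forall s, 0 < rho s) /\
    (forall s, Phi (s + 1) = Phi s + 2 * PI * INR n) /\
    (forall s, rho (s + 1) = rho s) /\
    (forall s, z (s + 1) = z s) /\
    (forall s s', 0 <= s < 1 -> 0 <= s' < 1 ->
       cyl (Phi s) (rho s) (z s) = cyl (Phi s') (rho s') (z s') -> s = s') /\
    (forall s, Derive Phi s <> 0) /\
    (forall p, K p <-> exists s, p = cyl (Phi s) (rho s) (z s)) /\
    (forall p, K p -> solid_torus r p).

(* [branch K phi0 rho z]: phi |-> (phi, rho phi, z phi), for phi near phi0, is a
   local branch of K written as a graph over phi. *)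
Definition branch (K : R * R * R -> Prop) (phi0 : R) (rho z : R -> R) : Prop :=
  smooth_near rho phi0 /\ smooth_near z phi0 /\
  locally phi0 (fun phi => 0 < rho phi /\ K (cyl phi (rho phi) (z phi))).

Definition multiple_point (K : R * R * R -> Prop) (q : R * R) : Prop :=
  exists p1 p2, K p1 /\ K p2 /\ p1 <> p2 /\ pr p1 = q /\ pr p2 = q.

(* Exactly two points of K project to the point (phi0, rho1 phi0), and the
   branches of K through them are (rho1, z1) and (rho2, z2). *)
Definition two_branches (K : R * R * R -> Prop) (phi0 : R)
    (rho1 z1 rho2 z2 : R -> R) : Prop :=
  branch K phi0 rho1 z1 /\ branch K phi0 rho2 z2 /\
  rho1 phi0 - rho2 phi0 = 0 /\ z1 phi0 <> z2 phi0 /\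
  (forall p, K p -> pr p = polar phi0 (rho1 phi0) ->
     p = cyl phi0 (rho1 phi0) (z1 phi0) \/ p = cyl phi0 (rho2 phi0) (z2 phi0)).

Definition ordinary_double_point (K : R * R * R -> Prop) (q : R * R) : Prop :=
  exists phi0 rho1 z1 rho2 z2,
    q = polar phi0 (rho1 phi0) /\
    two_branches K phi0 rho1 z1 rho2 z2 /\
    Derive (fun phi => rho1 phi - rho2 phi) phi0 <> 0.

Definition autotangency_branches (K : R * R * R -> Prop) (phi0 : R)
    (rho1 z1 rho2 z2 : R -> R) : Prop :=
  two_branches K phi0 rho1 z1 rho2 z2 /\
  Derive (fun phi => rho1 phi - rho2 phi) phi0 = 0 /\
  Derive_n (fun phi => rho1 phi - rho2 phi) 2 phi0 <> 0.

Definition ordinary_autotangency (K : R * R * R -> Prop) (q : R * R) : Prop :=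
  exists phi0 rho1 z1 rho2 z2,
    q = polar phi0 (rho1 phi0) /\
    autotangency_branches K phi0 rho1 z1 rho2 z2.

Definition Sigma_tan (r : R) (n : nat) (K : R * R * R -> Prop) : Prop :=
  closed_braid_knot r n K /\
  (exists! q, ordinary_autotangency K q) /\
  (forall q, multiple_point K q ->
     ordinary_double_point K q \/ ordinary_autotangency K q).

(* A local branch, near (phi0, t0), of a one-parameter family B of subsets. *)
Definition family_branch (B : R -> R * R * R -> Prop) (phi0 t0 : R)
    (rho z : R -> R -> R) : Prop :=
  smooth_near_2d rho phi0 t0 /\ smooth_near_2d z phi0 t0 /\
  locally_2d (fun phi t =>
    0 < rho phi t /\ B t (cyl phi (rho phi t) (z phi t))) phi0 t0.

Definition family_autotangency (B : R -> R * R * R -> Prop) (phi0 t0 : R)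
    (rho1 z1 rho2 z2 : R -> R -> R) : Prop :=
  family_branch B phi0 t0 rho1 z1 /\ family_branch B phi0 t0 rho2 z2 /\
  autotangency_branches (B t0) phi0
    (fun phi => rho1 phi t0) (fun phi => z1 phi t0)
    (fun phi => rho2 phi t0) (fun phi => z2 phi t0).

(* For a family B with B t0 in Sigma_tan.  The branches are unique as germs up
   to exchanging them and adding a multiple of 2 pi to phi0, so it does not
   matter whether they are quantified existentially or universally. *)
Definition transverse_at (B : R -> R * R * R -> Prop) (t0 : R) : Prop :=
  exists phi0 rho1 z1 rho2 z2,
    family_autotangency B phi0 t0 rho1 z1 rho2 z2 /\
    Derive (fun t => rho1 phi0 t - rho2 phi0 t) t0 <> 0.

Definition tangential_at (B : R -> R * R * R -> Prop) (t0 : R) : Prop :=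
  exists phi0 rho1 z1 rho2 z2,
    family_autotangency B phi0 t0 rho1 z1 rho2 z2 /\
    Derive (fun t => rho1 phi0 t - rho2 phi0 t) t0 = 0.

(* The canonical loop: at time t every disc {phi} x D^2 is rotated by the angle
   t around its centre (rho, z) = (1, 0). *)
Definition rot (K : R * R * R -> Prop) (t : R) (p : R * R * R) : Prop :=
  exists phi rho z, 0 < rho /\ K (cyl phi rho z) /\
    p = cyl phi (1 + (rho - 1) * cos t - z * sin t)
                ((rho - 1) * sin t + z * cos t).

(* Main.v *)
Require Import Defs.
From Stdlib Require Import Reals Lra Lia ZArith Classical FunctionalExtensionality.
From Coquelicot Require Import Coquelicot.
Open Scope R_scope.

(** A half plane meets the knot in finitely many points, because [phi] is
    non-singular on it.  Hence near a given time a continuous family of points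
    of the rotating knot staying in that half plane is carried along by the
    rotation.  The rotation moves the two points of an autotangency, which have
    the same [rho] and heights [z1 <> z2], with radial velocities [- z1] and
    [- z2], so the derivative of [rho1 - rho2] is [z2 - z1 <> 0]. *)

(** * Rotation of the meridian disc about [(1, 0)] *)

Definition rot_rho (t a b : R) : R := 1 + (a - 1) * cos t - b * sin t.

Definition rot_z (t a b : R) : R := (a - 1) * sin t + b * cos t.

Definition in_disc (r a b : R) : Prop := (a - 1) ^ 2 + b ^ 2 <= r ^ 2.

Lemma rot_rho_rot s t a b :
  rot_rho t (rot_rho s a b) (rot_z s a b) = rot_rho (s + t) a b.
Proof. unfold rot_rho, rot_z. rewrite cos_plus, sin_plus. ring. Qed.

Lemma rot_z_rot s t a b :
  rot_z t (rot_rho s a b) (rot_z s a b) = rot_z (s + t) a b.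
Proof. unfold rot_rho, rot_z. rewrite cos_plus, sin_plus. ring. Qed.

Lemma rot_rho_0 a b : rot_rho 0 a b = a.
Proof. unfold rot_rho. rewrite cos_0, sin_0. ring. Qed.

Lemma rot_z_0 a b : rot_z 0 a b = b.
Proof. unfold rot_z. rewrite cos_0, sin_0. ring. Qed.

Lemma in_disc_rot r t a b :
  in_disc r a b -> in_disc r (rot_rho t a b) (rot_z t a b).
Proof.
  unfold in_disc, rot_rho, rot_z. intros H.
  pose proof (sin2_cos2 t) as E. unfold Rsqr in E.
  replace ((1 + (a - 1) * cos t - b * sin t - 1) ^ 2
           + ((a - 1) * sin t + b * cos t) ^ 2)
    with (((a - 1) ^ 2 + b ^ 2) * (sin t * sin t + cos t * cos t)) by ring.
  rewrite E. lra.
Qed.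

(** Together with [in_disc_rot] this keeps the radius positive along the whole loop. Positivity is
    what makes cylindrical coordinates injective, and [rot] and [branch] both demand it. *)
Lemma in_disc_pos r a b : 0 < r < 1 -> in_disc r a b -> 0 < a.
Proof. unfold in_disc. intros Hr H. nra. Qed.

(** * Cylindrical coordinates and the ambiguity of the angle *)

Lemma polar_inj phi a phi' a' :
  0 < a -> 0 < a' -> polar phi a = polar phi' a' ->
  a = a' /\ cos phi = cos phi' /\ sin phi = sin phi'.
Proof.
  unfold polar. intros Ha Ha' H. injection H as Hc Hs.
  pose proof (sin2_cos2 phi) as E. pose proof (sin2_cos2 phi') as E'.
  unfold Rsqr in E, E'.
  (* The sum of the squares of the Cartesian coordinates recovers the radius; dividing by it
     afterwards recovers the direction. *)
  assert (Haa : a * a = a' * a').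
  { replace (a * a) with ((a * cos phi) * (a * cos phi)
      + (a * sin phi) * (a * sin phi)).
    - rewrite Hc, Hs.
      replace (a' * a') with (a' * a' * 1) by ring. rewrite <- E'. ring.
    - replace (a * a) with (a * a * 1) by ring. rewrite <- E. ring. }
  assert (a = a') by nra. subst a'.
  repeat split; apply Rmult_eq_reg_l with a; lra.
Qed.

Lemma cyl_inj phi a b phi' a' b' :
  0 < a -> 0 < a' -> cyl phi a b = cyl phi' a' b' ->
  a = a' /\ b = b' /\ cos phi = cos phi' /\ sin phi = sin phi'.
Proof.
  unfold cyl. intros Ha Ha' H.
  assert (Hp := f_equal fst H). assert (Hz := f_equal snd H). simpl in Hp, Hz.
  destruct (polar_inj _ _ _ _ Ha Ha' Hp) as (? & ? & ?). tauto.
Qed.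

Lemma cyl_angle phi phi' a b :
  cos phi = cos phi' -> sin phi = sin phi' -> cyl phi a b = cyl phi' a b.
Proof. unfold cyl, polar. intros -> ->. reflexivity. Qed.

(** The difference formula gives [cos (phi - phi') = 1]. The half-angle formula then makes the sine
    of half the difference vanish, so that half is a multiple of [PI]. *)
Lemma cos_sin_eq phi phi' :
  cos phi = cos phi' -> sin phi = sin phi' ->
  exists k : Z, phi = phi' + 2 * PI * IZR k.
Proof.
  intros Hc Hs.
  assert (H : cos (2 * ((phi - phi') / 2)) = 1).
  { replace (2 * ((phi - phi') / 2)) with (phi - phi') by field.
    rewrite cos_minus, Hc, Hs.
    pose proof (sin2_cos2 phi') as E. unfold Rsqr in E. lra. }
  rewrite cos_2a_sin in H.
  destruct (sin_eq_0_0 ((phi - phi') / 2)) as [k Hk]; [nra|].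
  exists k. lra.
Qed.

(** * Finiteness of the intersection with a half plane *)

Lemma Derive_neq_0_inj f :
  (forall x, ex_derive f x) -> (forall x, Derive f x <> 0) ->
  forall x y, f x = f y -> x = y.
Proof.
  intros Hd Hn x y Hxy.
  destruct (MVT_gen f x y (Derive f)) as (c & _ & Hc).
  - intros u _. apply Derive_correct, Hd.
  - intros u _. apply continuity_pt_filterlim.
    apply (ex_derive_continuous (V := R_NormedModule)), Hd.
  - rewrite Hxy, Rminus_diag in Hc.
    symmetry in Hc. apply Rmult_integral in Hc.
    destruct Hc as [Hc | Hc]; [now apply Hn in Hc | lra].
Qed.

Lemma shift_nat (f : R -> R) c :
  (forall s, f (s + 1) = f s + c) ->
  forall (m : nat) s, f (s + INR m) = f s + c * INR m.
Proof.
  intros H m; induction m as [|m IH]; intros s.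
  - simpl. rewrite Rplus_0_r. ring.
  - rewrite S_INR. replace (s + (INR m + 1)) with ((s + INR m) + 1) by ring.
    rewrite H, IH. ring.
Qed.

(** Used with [c = 0] for the periodic [rho] and [z], and with [c = 2 * PI * INR n] for the lifted
    angle [Phi]. *)
Lemma shift_Z (f : R -> R) c :
  (forall s, f (s + 1) = f s + c) ->
  forall (m : Z) s, f (s + IZR m) = f s + c * IZR m.
Proof.
  intros H m s. destruct (Z.le_gt_cases 0 m) as [Hm | Hm].
  - rewrite <- (Z2Nat.id m Hm), <- INR_IZR_INZ. now apply shift_nat.
  - pose proof (shift_nat f c H (Z.to_nat (- m)) (s + IZR m)) as E.
    rewrite INR_IZR_INZ, Z2Nat.id in E by lia. rewrite opp_IZR in E.
    replace (s + IZR m + - IZR m) with s in E by ring. lra.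
Qed.

(** In the application [k] labels a lift of the angle and [(u, v)] is the knot point over it. Each
    new index contributes at most one point, and [d] is shrunk to exclude that point unless it is
    [(a, b)]. *)
Lemma finite_isolated (Q : nat -> R -> R -> Prop) (a b : R) :
  (forall k u v u' v', Q k u v -> Q k u' v' -> u = u' /\ v = v') ->
  forall N, exists d, 0 < d /\ forall k u v, (k < N)%nat -> Q k u v ->
    Rabs (u - a) < d -> Rabs (v - b) < d -> u = a /\ v = b.
Proof.
  intros HQ N; induction N as [|N (d & Hd & IH)].
  - exists 1. split; [lra|]. intros; lia.
  - destruct (classic (exists u v, Q N u v /\ ~ (u = a /\ v = b)))
      as [(u & v & Huv & Hne) | Hno].
    + assert (Hpos : 0 < Rmax (Rabs (u - a)) (Rabs (v - b))).
      { destruct (Req_dec u a) as [->|Hu].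
        - apply Rlt_le_trans with (Rabs (v - b)); [|apply Rmax_r].
          apply Rabs_pos_lt. intros E. apply Hne. split; lra.
        - apply Rlt_le_trans with (Rabs (u - a)); [|apply Rmax_l].
          apply Rabs_pos_lt. lra. }
      (* The second bound is the sup distance from [(a, b)] to the single point of index [N]; the
         strict inequalities keep that point out. *)
      exists (Rmin d (Rmax (Rabs (u - a)) (Rabs (v - b)))).
      split; [now apply Rmin_pos|].
      intros k u' v' Hk Hq H1 H2.
      pose proof (Rmin_l d (Rmax (Rabs (u - a)) (Rabs (v - b)))).
      pose proof (Rmin_r d (Rmax (Rabs (u - a)) (Rabs (v - b)))).
      destruct (Nat.eq_dec k N) as [->|Hn].
      * exfalso. destruct (HQ _ _ _ _ _ Huv Hq) as [<- <-].
        pose proof (Rmax_lub_lt (Rabs (u - a)) (Rabs (v - b))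
          (Rmax (Rabs (u - a)) (Rabs (v - b)))). lra.
      * apply (IH k); [lia | assumption | lra | lra].
    + exists d. split; [assumption|]. intros k u v Hk Hq H1 H2.
      destruct (Nat.eq_dec k N) as [->|Hn].
      * apply NNPP. intros Hne. apply Hno. now exists u, v.
      * apply (IH k); [lia | assumption | lra | lra].
Qed.

(** [Phi] is injective, so each lift of the angle is attained at most once. It is also bounded on
    one period, so only finitely many lifts [phi0 + 2 * PI * k] are attained there. *)
Lemma half_plane_isolated r n K phi0 a b :
  closed_braid_knot r n K ->
  exists d, 0 < d /\ forall a' b', 0 < a' -> K (cyl phi0 a' b') ->
    Rabs (a' - a) < d -> Rabs (b' - b) < d -> a' = a /\ b' = b.
Proof.
  intros (Phi & rho & z & HPhi & _ & _ & Hpos & PPhi & Prho & Pz & _ & HD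
    & HK & _).
  assert (Hex : forall x, ex_derive Phi x) by (intros x; exact (HPhi 1%nat x)).
  assert (Hinj := Derive_neq_0_inj Phi Hex HD).
  assert (Hcont : forall c, 0 <= c <= 1 -> continuity_pt Phi c).
  { intros c _. apply continuity_pt_filterlim.
    apply (ex_derive_continuous (V := R_NormedModule)), Hex. }
  destruct (continuity_ab_maj Phi 0 1 Rle_0_1 Hcont) as (xM & HM & _).
  destruct (continuity_ab_min Phi 0 1 Rle_0_1 Hcont) as (xm & Hm & _).
  (* [C] bounds the distance from [phi0] to the values of [Phi] on [[0, 1]]. As [2 * PI > 1], every
     lift met there has [k] strictly between [- B] and [B]; adding [B] indexes these lifts by
     naturals below [2 * B]. *)
  set (C := Rabs (Phi xM - phi0) + Rabs (Phi xm - phi0)).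
  set (B := up C).
  assert (HB : C < IZR B) by apply archimed.
  assert (HC : 0 <= C)
    by (unfold C; pose proof (Rabs_pos (Phi xM - phi0));
        pose proof (Rabs_pos (Phi xm - phi0)); lra).
  assert (HB0 : (0 < B)%Z) by (apply lt_IZR; lra).
  destruct (finite_isolated
    (fun k u v => exists s, Phi s = phi0 + 2 * PI * IZR (Z.of_nat k - B)
       /\ u = rho s /\ v = z s) a b) with (N := Z.to_nat (2 * B))
    as (d & Hd & Hiso).
  { intros k u v u' v' (s & Hs & -> & ->) (s' & Hs' & -> & ->).
    rewrite <- Hs' in Hs. now rewrite (Hinj _ _ Hs). }
  exists d. split; [assumption|]. intros a' b' Ha' HKp H1 H2.
  apply HK in HKp. destruct HKp as (s & Hs).
  apply cyl_inj in Hs; [|assumption|apply Hpos].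
  destruct Hs as (Ea & Eb & Ec & Es).
  (* The parameter is reduced modulo 1. This leaves [rho] and [z] unchanged, and the whole turns
     lost by [Phi] are absorbed into the integer [k0]. *)
  set (s0 := s - IZR (Int_part s)).
  assert (Hs0 : 0 <= s0 <= 1).
  { unfold s0. pose proof (base_Int_part s). lra. }
  assert (Hss : s = s0 + IZR (Int_part s)) by (unfold s0; ring).
  assert (Er : rho s = rho s0).
  { rewrite Hss at 1. rewrite (shift_Z rho 0); [ring|].
    intros; rewrite Prho; ring. }
  assert (Ez : z s = z s0).
  { rewrite Hss at 1. rewrite (shift_Z z 0); [ring|].
    intros; rewrite Pz; ring. }
  assert (EPhi : Phi s = Phi s0 + 2 * PI * IZR (Z.of_nat n * Int_part s)).
  { rewrite Hss at 1. rewrite (shift_Z Phi _ PPhi), mult_IZR, <- INR_IZR_INZ.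
    ring. }
  destruct (cos_sin_eq _ _ (eq_sym Ec) (eq_sym Es)) as (k & Hk).
  set (k0 := (k - Z.of_nat n * Int_part s)%Z).
  assert (Hk0 : Phi s0 = phi0 + 2 * PI * IZR k0).
  { unfold k0. rewrite minus_IZR. lra. }
  assert (Hb : Rabs (IZR k0) <= C).
  { specialize (HM s0 Hs0). specialize (Hm s0 Hs0).
    assert (Hb1 : Rabs (2 * PI * IZR k0) <= C).
    { replace (2 * PI * IZR k0) with (Phi s0 - phi0) by lra. unfold C.
      unfold Rabs; repeat destruct Rcase_abs; lra. }
    pose proof PI2_1. pose proof (Rabs_pos (IZR k0)).
    rewrite Rabs_mult, (Rabs_right (2 * PI)) in Hb1 by lra. nra. }
  assert (Hlo : (- B < k0 < B)%Z).
  { apply Rabs_le_between in Hb.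
    split; apply lt_IZR; rewrite ?opp_IZR; lra. }
  apply (Hiso (Z.to_nat (k0 + B)) a' b'); [lia | | assumption | assumption].
  exists s0. rewrite Z2Nat.id by lia.
  replace (k0 + B - B)%Z with k0 by lia.
  split; [assumption|]. split; congruence.
Qed.

(** * Composing and inverting rotations of a closed braid *)

Lemma closed_braid_in_disc r n K phi a b :
  closed_braid_knot r n K -> 0 < a -> K (cyl phi a b) -> in_disc r a b.
Proof.
  intros (Phi & rho & z & H) Ha HKp.
  destruct H as (_ & _ & _ & _ & _ & _ & _ & _ & _ & _ & Hsol).
  destruct (Hsol _ HKp) as (phi' & a' & b' & Ha' & Hd & E).
  destruct (cyl_inj _ _ _ _ _ _ Ha Ha' E) as (-> & -> & _). exact Hd.
Qed.

(** The intermediate point, reached after the angle [s], stays in the disc of radius [r < 1], so it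
    has the positive radius that [rot] demands. *)
Lemma rot_rot_sub r n K s t p :
  0 < r < 1 -> closed_braid_knot r n K ->
  rot K (s + t) p -> rot (rot K s) t p.
Proof.
  intros Hr HK (phi & a & b & Ha & HKp & ->).
  assert (Hd := closed_braid_in_disc r n K _ _ _ HK Ha HKp).
  exists phi, (rot_rho s a b), (rot_z s a b). split; [|split].
  - apply (in_disc_pos r _ (rot_z s a b) Hr). now apply in_disc_rot.
  - now exists phi, a, b.
  - change (cyl phi (rot_rho (s + t) a b) (rot_z (s + t) a b)
      = cyl phi (rot_rho t (rot_rho s a b) (rot_z s a b))
          (rot_z t (rot_rho s a b) (rot_z s a b))).
    now rewrite rot_rho_rot, rot_z_rot.
Qed.

Lemma rot_back r n K t phi a b :
  0 < r < 1 -> closed_braid_knot r n K -> 0 < a -> rot K t (cyl phi a b) ->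
  0 < rot_rho (- t) a b /\ K (cyl phi (rot_rho (- t) a b) (rot_z (- t) a b)).
Proof.
  intros Hr HK Ha (phi' & a' & b' & Ha' & HKp & E).
  change (cyl phi a b = cyl phi' (rot_rho t a' b') (rot_z t a' b')) in E.
  assert (Hd := closed_braid_in_disc r n K _ _ _ HK Ha' HKp).
  assert (Hp := in_disc_pos r _ _ Hr (in_disc_rot r t _ _ Hd)).
  destruct (cyl_inj _ _ _ _ _ _ Ha Hp E) as (-> & -> & Ec & Es).
  rewrite rot_rho_rot, rot_z_rot, Rplus_opp_r, rot_rho_0, rot_z_0.
  split; [assumption|]. now rewrite (cyl_angle _ _ _ _ Ec Es).
Qed.

Lemma rot_add r n K s t phi a b :
  0 < r < 1 -> closed_braid_knot r n K -> 0 < a -> rot K s (cyl phi a b) ->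
  0 < rot_rho t a b /\ rot K (s + t) (cyl phi (rot_rho t a b) (rot_z t a b)).
Proof.
  intros Hr HK Ha (phi' & a' & b' & Ha' & HKp & E).
  change (cyl phi a b = cyl phi' (rot_rho s a' b') (rot_z s a' b')) in E.
  assert (Hd := closed_braid_in_disc r n K _ _ _ HK Ha' HKp).
  assert (Hp := in_disc_pos r _ _ Hr (in_disc_rot r s _ _ Hd)).
  destruct (cyl_inj _ _ _ _ _ _ Ha Hp E) as (-> & -> & Ec & Es).
  rewrite rot_rho_rot, rot_z_rot. split.
  - apply (in_disc_pos r _ (rot_z (s + t) a' b') Hr). now apply in_disc_rot.
  - exists phi', a', b'. split; [assumption|]. split; [assumption|].
    now apply cyl_angle.
Qed.

(** * Joint smoothness of rotated branches in angle and time *)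

Lemma smooth_near_Derive f x : smooth_near f x -> smooth_near (Derive f) x.
Proof.
  intros [d Hd]. exists d. intros u Hu k. specialize (Hd u Hu (S k)).
  destruct k as [|k]; [exact I|].
  simpl in Hd |- *. apply ex_derive_ext with (2 := Hd).
  intros v. change (Derive f) with (Derive_n f 1).
  rewrite Derive_n_comp. now replace (k + 1)%nat with (S k) by lia.
Qed.

Lemma smooth_near_opp f x :
  smooth_near f x -> smooth_near (fun u => - f u) x.
Proof.
  intros [d Hd]. exists d. intros u Hu k. apply ex_derive_n_opp, (Hd u Hu).
Qed.

Lemma smooth_near_const c x : smooth_near (fun _ => c) x.
Proof. exists (mkposreal 1 Rlt_0_1). intros u _ k. apply ex_derive_n_const. Qed.

Lemma smooth_near_ex_derive f x : smooth_near f x -> ex_derive f x.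
Proof. intros H. exact (locally_singleton _ _ H 1%nat). Qed.

Lemma smooth_near_continuity_2d f x y :
  smooth_near f x -> continuity_2d_pt (fun u _ => f u) x y.
Proof.
  intros H. apply (continuity_1d_2d_pt_comp f (fun u _ => u)).
  - apply continuity_pt_filterlim, (ex_derive_continuous (V := R_NormedModule)).
    now apply smooth_near_ex_derive.
  - apply continuity_2d_pt_id1.
Qed.

(* The induction works because this shape is stable under both partial
   derivatives. *)
Lemma ex_diff_n_trig k : forall (c g h : R -> R) (y0 x y : R),
  smooth_near c x -> smooth_near g x -> smooth_near h x ->
  ex_diff_n (fun u v => c u + g u * cos (v - y0) + h u * sin (v - y0)) k x y.
Proof.
  induction k as [|k IH]; intros c g h y0 x y Hc Hg Hh;
    (split; [|try exact I]).
  (* The two goals selected are the continuity conditions at order 0 and at successor order. *)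
  1, 2: assert (Hv : continuity_2d_pt (fun _ v => v - y0) x y)
      by (apply continuity_2d_pt_minus;
          [apply continuity_2d_pt_id2 | apply continuity_2d_pt_const]);
    repeat apply continuity_2d_pt_plus;
    try apply continuity_2d_pt_mult;
    try (now apply smooth_near_continuity_2d);
    [apply (continuity_1d_2d_pt_comp cos (fun _ v => v - y0));
       [apply continuity_cos | assumption]
    |apply (continuity_1d_2d_pt_comp sin (fun _ v => v - y0));
       [apply continuity_sin | assumption]].
  split; [|split; [|split]].
  - assert (H1 := smooth_near_ex_derive _ _ Hc).
    assert (H2 := smooth_near_ex_derive _ _ Hg).
    assert (H3 := smooth_near_ex_derive _ _ Hh).
    auto_derive. tauto.
  - auto_derive. exact I.
  - apply ex_diff_n_ext_loc with (fun u v =>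
      Derive c u + Derive g u * cos (v - y0) + Derive h u * sin (v - y0)).
    + destruct (filter_and _ _ Hc (filter_and _ _ Hg Hh)) as [d Hd].
      exists d. intros u v Hu _. destruct (Hd u Hu) as (H1 & H2 & H3).
      specialize (H1 1%nat). specialize (H2 1%nat). specialize (H3 1%nat).
      simpl in H1, H2, H3.
      symmetry. apply is_derive_unique. auto_derive; [tauto|].
      change (fun x => c x) with c. change (fun x => g x) with g.
      change (fun x => h x) with h. ring.
    + apply IH; now apply smooth_near_Derive.
  - apply ex_diff_n_ext_loc with (fun u v =>
      0 + h u * cos (v - y0) + (- g u) * sin (v - y0)).
    + exists (mkposreal 1 Rlt_0_1). intros u v _ _.
      symmetry. apply is_derive_unique. auto_derive; [exact I|].
      unfold Rminus. ring.
    + apply (IH (fun _ => 0)); [apply smooth_near_const | assumption |].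
      now apply smooth_near_opp.
Qed.

(** Both coordinates of a rotated branch have this form, with [u] the angle, [v] the time and [y0]
    the base time. *)
Lemma smooth_near_2d_trig (c g h : R -> R) (y0 x y : R) :
  smooth_near c x -> smooth_near g x -> smooth_near h x ->
  smooth_near_2d
    (fun u v => c u + g u * cos (v - y0) + h u * sin (v - y0)) x y.
Proof.
  intros Hc Hg Hh.
  destruct (filter_and _ _ (locally_locally _ _ Hc)
    (filter_and _ _ (locally_locally _ _ Hg) (locally_locally _ _ Hh)))
    as [d Hd].
  exists d. intros u v Hu _ k. destruct (Hd u Hu) as (H1 & H2 & H3).
  now apply ex_diff_n_trig.
Qed.

Lemma smooth_near_sub_1 f x :
  smooth_near f x -> smooth_near (fun u => f u - 1) x.
Proof.
  intros Hf. unfold smooth_near.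
  apply filter_imp with (2 := locally_locally _ _ Hf). intros u Hu k.
  apply ex_derive_n_minus.
  - apply filter_imp with (2 := Hu). auto.
  - apply filter_forall. intros. apply ex_derive_n_const.
Qed.

(** This supplies the witnesses for [transverse_at]: a branch of the braid at time [t0] extends to
    nearby times by rotating it. *)
Lemma rot_family_branch r n K t0 phi0 rho z :
  0 < r < 1 -> closed_braid_knot r n K -> branch (rot K t0) phi0 rho z ->
  family_branch (rot K) phi0 t0
    (fun phi t => rot_rho (t - t0) (rho phi) (z phi))
    (fun phi t => rot_z (t - t0) (rho phi) (z phi)).
Proof.
  intros Hr HK (Hrho & Hz & [d Hd]). split; [|split].
  - unfold rot_rho.
    replace (fun phi t => 1 + (rho phi - 1) * cos (t - t0) - z phi * sin (t - t0))
      with (fun phi t => 1 + (rho phi - 1) * cos (t - t0)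
                         + (- z phi) * sin (t - t0)).
    + apply (smooth_near_2d_trig (fun _ => 1) (fun u => rho u - 1)
        (fun u => - z u)).
      * apply smooth_near_const.
      * now apply smooth_near_sub_1.
      * now apply smooth_near_opp.
    + extensionality phi; extensionality t. ring.
  - unfold rot_z.
    replace (fun phi t => (rho phi - 1) * sin (t - t0) + z phi * cos (t - t0))
      with (fun phi t => 0 + z phi * cos (t - t0)
                         + (rho phi - 1) * sin (t - t0)).
    + apply (smooth_near_2d_trig (fun _ => 0) z (fun u => rho u - 1)).
      * apply smooth_near_const.
      * assumption.
      * now apply smooth_near_sub_1.
    + extensionality phi; extensionality t. ring.
  - exists d. intros u v Hu _. destruct (Hd u Hu) as (Hp & HKp).
    replace v with (t0 + (v - t0)) at 2 by ring.
    exact (rot_add r n K t0 (v - t0) u _ _ Hr HK Hp HKp).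
Qed.

(** * Every branch of the loop follows the rotation *)

Lemma smooth_near_2d_ex_derive f x y :
  smooth_near_2d f x y -> ex_derive (fun t => f x t) y.
Proof.
  intros H. apply locally_2d_singleton in H.
  destruct (H 1%nat) as (_ & _ & Hd & _). exact Hd.
Qed.

(** Excluding [tangential_at] requires control of arbitrary family branches. Rotating such a branch
    back to time [t0] confines it to the isolated points of a half plane. *)
Lemma family_branch_rot r n K t0 phi0 rho z :
  0 < r < 1 -> closed_braid_knot r n K -> closed_braid_knot r n (rot K t0) ->
  family_branch (rot K) phi0 t0 rho z ->
  locally t0 (fun t =>
    rho phi0 t = rot_rho (t - t0) (rho phi0 t0) (z phi0 t0)).
Proof.
  intros Hr HK HK0 (Hrho & Hz & Hb).
  apply smooth_near_2d_ex_derive in Hrho, Hz.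
  apply locally_2d_1d_const_x in Hb.
  set (a := rho phi0 t0). set (b := z phi0 t0).
  destruct (half_plane_isolated r n _ phi0 a b HK0) as (d & Hd & Hiso).
  (* [(A t, B t)] is the branch point over [phi0] at time [t], rotated back to time [t0]. It is
     continuous at [t0] with value [(a, b)], so near [t0] it enters the isolating neighbourhood and
     must equal [(a, b)]. *)
  set (A := fun t => rot_rho (- (t - t0)) (rho phi0 t) (z phi0 t)).
  set (B := fun t => rot_z (- (t - t0)) (rho phi0 t) (z phi0 t)).
  assert (HA : ex_derive A t0)
    by (unfold A, rot_rho; auto_derive; tauto).
  assert (HB : ex_derive B t0)
    by (unfold B, rot_z; auto_derive; tauto).
  assert (EA : A t0 = a)
    by (unfold A; rewrite Rminus_diag, Ropp_0; apply rot_rho_0).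
  assert (EB : B t0 = b)
    by (unfold B; rewrite Rminus_diag, Ropp_0; apply rot_z_0).
  apply (ex_derive_continuous (V := R_NormedModule)) in HA, HB.
  specialize (HA _ (locally_ball (A t0) (mkposreal d Hd))).
  specialize (HB _ (locally_ball (B t0) (mkposreal d Hd))).
  rewrite EA in HA. rewrite EB in HB.
  change (locally t0 (fun t => Rabs (A t - a) < d)) in HA.
  change (locally t0 (fun t => Rabs (B t - b) < d)) in HB.
  apply filter_imp with
    (2 := filter_and _ _ Hb (filter_and _ _ HA HB)).
  intros t ((Hp & HKp) & H1 & H2).
  (* The rotation is split at [t0], so that its second part can be undone on the knot [rot K t0]. *)
  replace t with (t0 + (t - t0)) in HKp at 1 by ring.
  apply (rot_rot_sub r n K t0 _ _ Hr HK) in HKp.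
  apply (rot_back r n _ _ _ _ _ Hr HK0 Hp) in HKp.
  destruct HKp as (HpA & HKA).
  destruct (Hiso _ _ HpA HKA H1 H2) as (E1 & E2).
  rewrite <- E1, <- E2, rot_rho_rot, Rplus_opp_l. symmetry. apply rot_rho_0.
Qed.

(** * Relative radial velocity and transversality *)

Lemma Derive_rot_rho_sub t0 a1 b1 a2 b2 :
  Derive (fun t => rot_rho (t - t0) a1 b1 - rot_rho (t - t0) a2 b2) t0
    = b2 - b1.
Proof.
  apply is_derive_unique. unfold rot_rho. auto_derive; [exact I|].
  replace (t0 + - t0) with 0 by ring. rewrite cos_0, sin_0. ring.
Qed.

Theorem mainTheorem2 (r : R) (hr : 0 < r < 1) (n : nat)
    (K : R * R * R -> Prop) (hK : closed_braid_knot r n K)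
    (t0 : R) (ht0 : 0 <= t0 <= 2 * PI) (hS : Sigma_tan r n (rot K t0)) :
  ~ tangential_at (rot K) t0 /\ transverse_at (rot K) t0.
Proof.
  destruct hS as (hK0 & (q & (phi0 & rho1 & z1 & rho2 & z2 & _ & Hauto) & _)
    & _).
  split.
  (* Tangency is refuted for whatever branches [tangential_at] provides, independently of those
     extracted from [Sigma_tan]. *)
  - clear - hr hK hK0.
    intros (phi0 & rho1 & z1 & rho2 & z2 & (Hb1 & Hb2 & Hauto) & HD).
    destruct Hauto as ((_ & _ & _ & Hz & _) & _).
    apply (family_branch_rot r n K t0 phi0 rho1 z1 hr hK hK0) in Hb1.
    apply (family_branch_rot r n K t0 phi0 rho2 z2 hr hK hK0) in Hb2.
    rewrite (Derive_ext_loc _ (fun t =>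
      rot_rho (t - t0) (rho1 phi0 t0) (z1 phi0 t0)
      - rot_rho (t - t0) (rho2 phi0 t0) (z2 phi0 t0))) in HD.
    + rewrite Derive_rot_rho_sub in HD. lra.
    + apply filter_imp with (2 := filter_and _ _ Hb1 Hb2).
      intros t (-> & ->). reflexivity.
  - assert (Hb := Hauto). destruct Hb as ((Hb1 & Hb2 & _ & Hz & _) & _).
    exists phi0,
      (fun phi t => rot_rho (t - t0) (rho1 phi) (z1 phi)),
      (fun phi t => rot_z (t - t0) (rho1 phi) (z1 phi)),
      (fun phi t => rot_rho (t - t0) (rho2 phi) (z2 phi)),
      (fun phi t => rot_z (t - t0) (rho2 phi) (z2 phi)).
    split; [|rewrite Derive_rot_rho_sub; lra].
    split; [now apply (rot_family_branch r n)|].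
    split; [now apply (rot_family_branch r n)|].
    (* At [t = t0] the rotation angle is zero, so the rotated families restrict to the original
       branches and [Hauto] applies to them. *)
    assert (Erho : forall f g : R -> R,
      (fun phi => rot_rho (t0 - t0) (f phi) (g phi)) = f).
    { intros f g. extensionality phi. rewrite Rminus_diag. apply rot_rho_0. }
    assert (Ez : forall f g : R -> R,
      (fun phi => rot_z (t0 - t0) (f phi) (g phi)) = g).
    { intros f g. extensionality phi. rewrite Rminus_diag. apply rot_z_0. }
    rewrite !Erho, !Ez. exact Hauto.
Qed.
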